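(* Let $n\in\mathbb{N}_+$ and let $\lambda,\mu$ be partitions. For $r\ge1$ and $c\ge1$ set \[a_r=\left\lfloor\frac{n|\lambda|-\sum_{i>r}\lambda_i}{r}\right\rfloor,\qquad b_c=\left\lfloor\frac{n|\lambda|-\sum_{j>c}\lambda'_j}{c}\right\rfloor.\] If $\langle s_\mu,\ p_n\circ s_\lambda\rangle\neq0$, then $\mu_r\le a_r$ for every $r\ge1$ and $\mu'_c\le b_c$ for every $c\ge1$. Equivalently, $[\mu]\subseteq[\Xi^1]\cap[\Xi^2]$, where $\Xi^1=(a_1,a_2,\dots)$ and $\Xi^2=(b_1,b_2,\dots)'$.
   Context: $\lambda'$ denotes the conjugate partition of $\lambda$, and $|\lambda|=\sum_i\lambda_i$. For a sequence $\alpha=(\alpha_1,\alpha_2,\dots)$ of nonnegative integers, $[\alpha]=\{(j,i)\in\mathbb{N}_0^2:0\le j<\alpha_{i+1}\}$. For a sequence $\beta=(b_1,b_2,\dots)$, $\beta'$ is understood via columns, so that $[(b_1,b_2,\dots)']=\{(j,i):0\le i<b_{j+1}\}$. $p_n$ is the $n$-th power sum, $\circ$ is plethysm, and $\langle\cdot,\cdot\rangle$ is the Hall inner product. *)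

(* Defs.v *)
From HB Require Import structures.
From mathcomp Require Import all_boot all_order all_algebra.
From mathcomp Require Import mpoly.
Set Implicit Arguments.
Unset Strict Implicit.
Unset Printing Implicit Defensive.
Import Order.TTheory GRing.Theory Num.Theory.
Local Open Scope ring_scope.

(* A partition is a weakly decreasing finite sequence of POSITIVE integers;
   part i (0-indexed) is nth 0 la i, i.e. lambda_{i+1}. *)
Definition is_partition (la : seq nat) : bool :=
  sorted geq la && all (fun x => 0 < x)%N la.

Definition psize (la : seq nat) : nat := sumn la.

Definition conjpart (la : seq nat) : seq nat :=
  mkseq (fun j => count (fun x => j < x)%N la) (foldr maxn 0%N la).

Definition incell (la : seq nat) (i j : nat) : bool := (j < nth 0 la i)%N.

(* Fillings of the box 'I_b x 'I_b (b = |la|, which contains the diagram of a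
   partition) with entries in {0..N-1} on the cells of la and None elsewhere. *)
Definition filling (la : seq nat) (N : nat) :=
  {ffun 'I_(sumn la) * 'I_(sumn la) -> option 'I_N}.

Definition is_ssyt (la : seq nat) (N : nat) (T : filling la N) : bool :=
  [forall c, (T c != None) == incell la c.1 c.2] &&
  [forall c1, forall c2,
     match T c1, T c2 with
     | Some a, Some b =>
         (((c1.1 == c2.1) && (c1.2 < c2.2)%N) ==> (a <= b)%N) &&
         (((c1.2 == c2.2) && (c1.1 < c2.1)%N) ==> (a < b)%N)
     | _, _ => true
     end].

Definition tab_monomial (la : seq nat) (N : nat) (T : filling la N)
  : {mpoly int[N]} :=
  \prod_(c : 'I_(sumn la) * 'I_(sumn la))
     (if T c is Some k then 'X_k else 1).

Definition schur (N : nat) (la : seq nat) : {mpoly int[N]} :=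
  \sum_(T : filling la N | is_ssyt T) tab_monomial T.

Definition pleth_pn_schur (n N : nat) (la : seq nat) : {mpoly int[N]} :=
  comp_mpoly [tuple ('X_i : {mpoly int[N]}) ^+ n | i < N] (schur N la).

Definition ptrim (N d : nat) (f : {ffun 'I_N -> 'I_d.+1}) : seq nat :=
  [seq x <- [seq (val (f i)) | i <- enum 'I_N] | (0 < x)%N].

Definition nonincr_ffun (N d : nat) (f : {ffun 'I_N -> 'I_d.+1}) : bool :=
  [forall i : 'I_N, forall j : 'I_N, (i <= j)%N ==> (f j <= f i)%N].

(* c is a Schur expansion of F (a symmetric polynomial of degree d in N >= d
   variables): c is supported on partitions of d and
   F = sum_{nu |- d} c nu * s_nu(x_1..x_N).  Every partition of d has at most
   d <= N parts, each <= d, so it is ptrim f for exactly one nonincreasing f. *)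
Definition schur_expansion (N d : nat) (F : {mpoly int[N]})
  (c : seq nat -> int) : Prop :=
  (forall nu, c nu != 0 -> is_partition nu /\ sumn nu = d) /\
  F = \sum_(f : {ffun 'I_N -> 'I_d.+1} | nonincr_ffun f)
        c (ptrim f) *: schur N (ptrim f).

(* <s_mu, p_n o s_la> <> 0 : in some (hence, by linear independence of Schur
   polynomials in N >= degree variables, the unique) Schur expansion of
   p_n o s_la, the coefficient of s_mu is nonzero. *)
Definition hall_pleth_nonzero (n : nat) (la mu : seq nat) : Prop :=
  exists N, (n * sumn la <= N)%N /\
    exists c, @schur_expansion N (n * sumn la)%N (pleth_pn_schur n N la) c
              /\ c mu != 0.

(* Main.v *)
Require Import Defs.
From HB Require Import structures.
From mathcomp Require Import all_boot all_order all_algebra.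
From mathcomp Require Import mpoly zify.
Set Implicit Arguments.
Unset Strict Implicit.
Unset Printing Implicit Defensive.
Import Order.TTheory GRing.Theory Num.Theory.

(** Both bounds follow from stronger dominance statements: every Schur
    constituent [mu] of [p_n o s_la] satisfies [mu <= n la] and [mu' <= n la'].

    For the rows, if [mu] is dominance-maximal among the constituents, then
    [x^mu] occurs in [s_la(x_1^n, x_2^n, ...)], by triangularity of the Kostka
    numbers.

    For the columns, the monomial coefficient is replaced by the functional
    [<e_beta, F> = \sum_rho (-1)^(d - l(rho)) [x^rho] F], where [rho] runs over
    the refinements of the composition [beta], with [beta = mu'].
    Standardization turns the tableaux of shape [la] counted here into standard
    tableaux with bounded descent set, and the signed sum over [rho] leaves only
    those standard tableaux that descend at every position that is not a partial
    sum of [beta]. Hence it detects [s_mu] triangularly with respect to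
    dominance of the conjugates. On [p_n o s_la] only the refinements [rho] with
    all parts divisible by [n] contribute, which reduces it to the same functional on
    [s_la] at [beta / n]. *)

(** * Partitions and column sums *)

Lemma sub_in_count (T : eqType) (P Q : pred T) (s : seq T) :
  {in s, subpred P Q} -> (count P s <= count Q s)%N.
Proof.
elim: s => //= z s IH sub.
have h : P z -> Q z by apply: sub; rewrite inE eqxx.
have /IH : {in s, subpred P Q} by move=> w ws; apply: sub; rewrite inE ws orbT.
by case: (P z) h => [->//|_]; lia.
Qed.

Lemma sub_in_count_lt (T : eqType) (P Q : pred T) (s : seq T) (x : T) :
  x \in s -> {in s, subpred P Q} -> Q x -> ~~ P x -> (count P s < count Q s)%N.
Proof.
elim: s => [//|y s IH]; rewrite inE => xs sub Qx Px /=.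
have sub' : {in s, subpred P Q} by move=> w ws; apply: sub; rewrite inE ws orbT.
have le := sub_in_count sub'.
have h : P y -> Q y by apply: sub; rewrite inE eqxx.
have [yx|yx] := eqVneq x y.
  by rewrite -yx Qx (negbTE Px); lia.
rewrite (negbTE yx) /= in xs.
have := IH xs sub' Qx Px.
by case: (P y) h => [->//|_]; lia.
Qed.

Lemma count_iota_ltn k m : count (fun p => p < k)%N (iota 0 m) = minn k m.
Proof. by elim: m => [|m IH]; rewrite ?minn0 // -addn1 iotaD count_cat IH /=; lia. Qed.

Lemma count_ltnS (X : Type) (f : X -> nat) s w : count (fun x => f x < w.+1)%N s =
   (count (fun x => f x < w)%N s + count (fun x => f x == w) s)%N.
Proof. by elim: s => //= x s ->; rewrite ltnS; case: (ltngtP (f x) w) => /=; lia. Qed.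

(** A down-closed predicate holds on an initial segment, and the count is the length of that
    segment. *)
Lemma count_iota_downclosed (P : pred nat) (e : nat) :
  {in gtn e &, forall p q, (p <= q)%N -> P q -> P p} ->
  forall p, (p < e)%N -> (p < count P (iota 0 e))%N = P p.
Proof.
elim: e => [//|e IH] down p pe; rewrite -[e.+1]addn1 iotaD count_cat /= add0n addn0.
have downe : {in gtn e &, forall p q, (p <= q)%N -> P q -> P p}.
  by move=> a b; rewrite !inE => ae be; apply: down; rewrite inE; lia.
have le : (count P (iota 0 e) <= e)%N by rewrite -{2}(size_iota 0 e) count_size.
case: (boolP (P e)) => Pe /=.
  have -> : count P (iota 0 e) = e.
    rewrite -{2}(size_iota 0 e); apply/eqP; rewrite -all_count; apply/allP => q.
    by rewrite mem_iota => h; apply: (down q e) => //; rewrite ?inE; lia.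
  by rewrite addn1 pe; apply/esym; apply: (down p e); rewrite ?inE ?leqnn; lia.
rewrite addn0; have [ltpe|] := ltnP p e; first exact: IH.
by move=> lep; have -> : p = e by [lia]; rewrite (negbTE Pe); apply/negbTE; rewrite -leqNgt.
Qed.

(** Each quotient is attained on a block of exactly [n] consecutive positions. *)
Lemma count_iota_divn (P : pred nat) (n e : nat) : (0 < n)%N ->
  count (fun p => P (p %/ n)%N) (iota 0 (n * e)) = (n * count P (iota 0 e))%N.
Proof.
move=> n0; elim: e => [|e IH]; first by rewrite muln0.
rewrite mulnS addnC iotaD count_cat IH -[in RHS]addn1 iotaD count_cat mulnDr /=.
congr addn; rewrite !add0n addn0.
have -> : count (fun p => P (p %/ n)%N) (iota (n * e) n) = count (fun=> P e) (iota (n * e) n).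
  apply: eq_in_count => p; rewrite mem_iota => h; congr P.
  by rewrite -[p](subnKC (proj1 (andP h))) mulnC divnMDl // divn_small ?addn0 //; lia.
by case: (P e); rewrite ?count_predT ?count_pred0 ?size_iota ?muln1 ?muln0.
Qed.

Lemma partition_nth_leq la i k : is_partition la -> (i <= k)%N ->
  (nth 0 la k <= nth 0 la i)%N.
Proof.
move=> /andP [so _] ik; have [h|h] := ltnP k (size la); last by rewrite nth_default.
have tr : transitive geq by move=> a b c /= h1 h2; exact: leq_trans h2 h1.
by apply: (sorted_leq_nth tr (fun x => leqnn x) 0%N so) => //; rewrite inE //; exact: leq_ltn_trans h.
Qed.

Lemma partition_nth_gt0 la i : is_partition la -> (0 < nth 0 la i)%N = (i < size la)%N.
Proof.
move=> /andP [_ /allP po]; have [h|h] := ltnP i (size la); last by rewrite nth_default.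
by apply: po; apply: mem_nth.
Qed.

Lemma nth_leq_sumn la i : (nth 0 la i <= sumn la)%N.
Proof.
elim: la i => [|x la IH] [|i] //=; first exact: leq_addr.
exact: leq_trans (IH i) (leq_addl _ _).
Qed.

Lemma size_leq_sumn la : all (fun x => 0 < x)%N la -> (size la <= sumn la)%N.
Proof. by elim: la => //= x la IH /andP [x0 /IH]; lia. Qed.

Lemma partition_eq la mu : is_partition la -> is_partition mu ->
  (forall i, nth 0 la i = nth 0 mu i) -> la = mu.
Proof.
move=> pl pm eqn.
have sz : size la = size mu.
  case: (ltngtP (size la) (size mu)) => // h.
    by move: h; rewrite -partition_nth_gt0 // -eqn partition_nth_gt0 // ltnn.
  by move: h; rewrite -partition_nth_gt0 // eqn partition_nth_gt0 // ltnn.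
by apply: (eq_from_nth (x0 := 0%N)) => // i _; apply: eqn.
Qed.

(** The two sides read the same cell in the conjugate and in the partition: the parts exceeding [j]
    form an initial segment of [la]. *)
Lemma partition_nth_count la i j : is_partition la ->
  (i < count (fun x => j < x)%N la)%N = (j < nth 0 la i)%N.
Proof.
move=> pl.
have -> : count (fun x => j < x)%N la
    = count (fun i => j < nth 0 la i)%N (iota 0 (size la)).
  by rewrite -{1}[la](mkseq_nth 0%N) /mkseq count_map.
have [h|h] := ltnP i (size la).
  apply: count_iota_downclosed => // p q _ _ pq /leq_trans; apply.
  exact: partition_nth_leq.
by rewrite nth_default // ltn0 ltnNge (leq_trans _ h) // -[X in (_ <= X)%N](size_iota 0) count_size.
Qed.

(* The sum of the first [k] parts of the conjugate partition. *)
Definition colsum (k : nat) (la : seq nat) : nat := sumn [seq minn k x | x <- la].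

Lemma colsum0 la : colsum 0 la = 0%N.
Proof. by rewrite /colsum; elim: la => //= x la ->; rewrite min0n. Qed.

Lemma colsumS k la : colsum k.+1 la = (colsum k la + count (fun x => k < x)%N la)%N.
Proof. by rewrite /colsum; elim: la => //= x la ->; case: (ltnP k x) => /=; lia. Qed.

Lemma leq_colsum k l la : (k <= l)%N -> (colsum k la <= colsum l la)%N.
Proof. by move=> kl; rewrite /colsum; elim: la => //= x la; lia. Qed.

Lemma colsum_leq_sumn k la : (colsum k la <= sumn la)%N.
Proof. by rewrite /colsum; elim: la => //= x la; lia. Qed.

Lemma foldr_maxn_geq x la : x \in la -> (x <= foldr maxn 0%N la)%N.
Proof.
by elim: la => //= y la IH; rewrite inE => /orP [/eqP ->|/IH];
  rewrite leq_max ?leqnn // => ->; rewrite orbT.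
Qed.

Lemma nth_conjpart la j : nth 0 (conjpart la) j = count (fun x => j < x)%N la.
Proof.
rewrite /conjpart; have [h|h] := ltnP j (foldr maxn 0%N la).
  by rewrite nth_mkseq.
rewrite nth_default ?size_mkseq //; apply/esym/eqP; rewrite -leqn0 leqNgt -has_count.
by apply/hasPn => x /foldr_maxn_geq; lia.
Qed.

Lemma sumn_take_nthS k (s : seq nat) : sumn (take k.+1 s) = (sumn (take k s) + nth 0 s k)%N.
Proof. by elim: s k => [|x s IH] [|k] //=; rewrite ?take0 ?addn0 // IH addnA. Qed.

Lemma sumn_take_conjpart k la : sumn (take k (conjpart la)) = colsum k la.
Proof.
elim: k => [|k IH]; first by rewrite take0 colsum0.
by rewrite sumn_take_nthS IH nth_conjpart colsumS.
Qed.

Lemma sumn_conjpart la : sumn (conjpart la) = sumn la.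
Proof.
rewrite -[conjpart la]take_size sumn_take_conjpart size_mkseq /colsum.
congr sumn; rewrite -[RHS]map_id; apply/eq_in_map => x /foldr_maxn_geq h.
by apply/minn_idPr.
Qed.

Lemma leq_mul_nonincr_sumn_take (s : seq nat) r :
  (forall i k, (i <= k)%N -> (nth 0 s k <= nth 0 s i)%N) ->
  (r.+1 * nth 0 s r <= sumn (take r.+1 s))%N.
Proof.
move=> ni; have h k : (k <= r.+1)%N -> (k * nth 0 s r <= sumn (take k s))%N.
  elim: k => [//|k IH] kr; rewrite sumn_take_nthS mulSn addnC leq_add ?IH ?ni //; lia.
exact: h.
Qed.

(** * Tableaux and coefficients of [p_n o s_la] *)

Definition cells (la : seq nat) : seq ('I_(sumn la) * 'I_(sumn la)) :=
  [seq c : 'I_(sumn la) * 'I_(sumn la) <- enum {: 'I_(sumn la) * 'I_(sumn la)}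
     | incell la c.1 c.2].

Lemma mem_cells la c : (c \in cells la) = incell la c.1 c.2.
Proof. by rewrite mem_filter mem_enum andbT. Qed.

Lemma cells_uniq la : uniq (cells la).
Proof. by rewrite filter_uniq ?enum_uniq. Qed.

(** Parts are positive, so there are at most [sumn la] rows, each of length at most [sumn la]; the
    whole diagram fits in the box that indexes fillings. *)
Lemma exists_cell la i j : is_partition la -> (j < nth 0 la i)%N ->
  exists2 c, c \in cells la & val c.1 = i /\ val c.2 = j.
Proof.
move=> pl ji.
have jd : (j < sumn la)%N by apply: leq_trans ji (nth_leq_sumn _ _).
have id : (i < sumn la)%N.
  apply: (leq_trans (n := size la)); last by apply: size_leq_sumn; case/andP: pl.
  by rewrite -partition_nth_gt0 //; lia.
by exists (Ordinal id, Ordinal jd); rewrite ?mem_cells.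
Qed.

Lemma sum_ltn_ord (s a : nat) : (\sum_(j < s) (j < a) = minn a s)%N.
Proof. by elim: s => [|s IH]; rewrite ?big_ord0 ?minn0 // big_ord_recr /= IH; lia. Qed.

Lemma sum_nth_ord (s : seq nat) m : (size s <= m)%N -> (\sum_(i < m) nth 0 s i = sumn s)%N.
Proof.
move=> h; rewrite sumnE (big_nth 0%N) -(big_mkord xpredT (nth 0%N s)).
rewrite (big_cat_nat _ h) //= [X in (_ + X)%N]big_nat [X in (_ + X)%N]big1 ?addn0 // => i /andP [hi _].
by rewrite nth_default.
Qed.

Lemma count_cellsE la (P : nat -> nat -> bool) :
  count (fun c => P (val c.1) (val c.2)) (cells la)
   = (\sum_(i < sumn la) \sum_(j < sumn la) (incell la i j && P i j))%N.
Proof.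
rewrite /cells count_filter -sum1_count pair_big_dep /= big_enum_cond big_mkcond /=.
by apply: congr_big => // i _; rewrite andbC; case: ifP.
Qed.

Lemma count_cells_col la k : is_partition la ->
  count (fun c => val c.2 < k)%N (cells la) = colsum k la.
Proof.
move=> pl; rewrite (count_cellsE _ (fun _ j => j < k)%N) /colsum.
have sz : (size la <= sumn la)%N by apply: size_leq_sumn; case/andP: pl.
rewrite -(@sum_nth_ord [seq minn k x | x <- la] (sumn la)) ?size_map //; apply: eq_bigr => i _.
have -> : nth 0%N [seq minn k x | x <- la] i = minn k (nth 0%N la i).
  have [h|h] := ltnP i (size la); first by rewrite (nth_map 0%N).
  by rewrite !nth_default ?size_map ?minn0.
transitivity (\sum_(j < sumn la) (j < minn k (nth 0 la i)))%N.
  by apply: eq_bigr => j _; rewrite /incell; congr nat_of_bool; lia.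
by rewrite sum_ltn_ord; have := nth_leq_sumn la i; lia.
Qed.

Lemma count_cells_row la k : is_partition la ->
  count (fun c => val c.1 < k)%N (cells la) = sumn (take k la).
Proof.
move=> pl; rewrite (count_cellsE _ (fun i _ => i < k)%N).
have sz : (size la <= sumn la)%N by apply: size_leq_sumn; case/andP: pl.
rewrite -(@sum_nth_ord (take k la) (sumn la)); last by rewrite size_take_min; lia.
apply: eq_bigr => i _; have [h|h] := ltnP i k.
  rewrite nth_take //; transitivity (\sum_(j < sumn la) (j < nth 0 la i))%N.
    by apply: eq_bigr => j _; rewrite /incell andbT.
  by rewrite sum_ltn_ord; have := nth_leq_sumn la i; lia.
rewrite nth_default ?size_take_min; last by lia.
by rewrite big1 // => j _; rewrite andbF.
Qed.

Lemma size_cells la : is_partition la -> size (cells la) = sumn la.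
Proof.
move=> pl; rewrite -[in RHS](take_size la) -count_cells_row // -count_predT.
apply: eq_in_count => c; rewrite mem_cells /incell => h.
by rewrite /= -partition_nth_gt0 //; apply/esym/(leq_ltn_trans _ h).
Qed.

Section Tableaux.
Variables (la : seq nat) (N : nat).
Implicit Types (T : filling la N) (c : 'I_(sumn la) * 'I_(sumn la)).

(** The value 0 outside the diagram is a default, so later statements about entries are restricted
    to [cells la]. *)
Definition entry T c : nat := if T c is Some k then val k else 0%N.

Definition semistandard T : Prop :=
  [/\ forall c, (T c != None) = (c \in cells la),
      {in cells la &, forall c c', c.1 = c'.1 -> (c.2 < c'.2)%N -> (entry T c <= entry T c')%N}
    & {in cells la &, forall c c', c.2 = c'.2 -> (c.1 < c'.1)%N -> (entry T c < entry T c')%N}].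

Lemma is_ssytP T : reflect (semistandard T) (is_ssyt T).
Proof.
apply: (iffP andP) => [[/forallP dom /forallP mon]|[dom row col]].
  have dom' c : (T c != None) = (c \in cells la) by rewrite mem_cells (eqP (dom c)).
  split=> // c c'; rewrite -!dom' /entry; have /forallP /(_ c') := mon c.
    case: (T c) => [a|//]; case: (T c') => [b|//] /andP [h _] _ _ e l.
    by apply: (implyP h); rewrite e eqxx.
  case: (T c) => [a|//]; case: (T c') => [b|//] /andP [_ h] _ _ e l.
  by apply: (implyP h); rewrite e eqxx.
split; first by apply/forallP => c; rewrite dom mem_cells.
apply/forallP => c; apply/forallP => c'.
have := row c c'; have := col c c'; rewrite -!dom /entry.
case: (T c) => [a|//]; case: (T c') => [b|//] /(_ isT isT) h1 /(_ isT isT) h2.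
by apply/andP; split; apply/implyP => /andP [/eqP e l]; [apply: h2|apply: h1].
Qed.

Lemma entry_lt T c : c \in cells la -> semistandard T -> (entry T c < N)%N.
Proof. by move=> cl [dom _ _]; move: cl; rewrite -dom /entry; case: (T c) => [a _|//]; exact: ltn_ord. Qed.

Lemma entry_inj T T' : semistandard T -> semistandard T' ->
  {in cells la, entry T =1 entry T'} -> T = T'.
Proof.
move=> [d _ _] [d' _ _] e; apply/ffunP => c; move: (d c) (d' c) (e c); rewrite /entry.
case: (T c) => [a|]; case: (T' c) => [b|] //=; case: (c \in cells la) => // _ _ /(_ isT).
by move/val_inj => ->.
Qed.

Definition fill (f : 'I_(sumn la) * 'I_(sumn la) -> nat) : filling la N :=
  [ffun c => if c \in cells la then insub (f c) else None].

Lemma entry_fill f c : (f c < N)%N -> c \in cells la -> entry (fill f) c = f c.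
Proof. by move=> fN cl; rewrite /entry ffunE cl insubT. Qed.

Lemma fill_semistandard f :
  {in cells la, forall c, (f c < N)%N} ->
  {in cells la &, forall c c', c.1 = c'.1 -> (c.2 < c'.2)%N -> (f c <= f c')%N} ->
  {in cells la &, forall c c', c.2 = c'.2 -> (c.1 < c'.1)%N -> (f c < f c')%N} ->
  semistandard (fill f).
Proof.
move=> fN row col; split=> [c|c c' cl cl'|c c' cl cl'].
- by rewrite ffunE; case: ifP => // cl; rewrite insubT // fN.
- by rewrite !entry_fill ?fN //; apply: row.
- by rewrite !entry_fill ?fN //; apply: col.
Qed.

Definition content T : 'X_{1..N} :=
  [multinom count (fun c => entry T c == v) (cells la) | v < N].

Lemma tab_monomialE T : is_ssyt T -> tab_monomial T = 'X_[content T].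
Proof.
move=> /is_ssytP [dom _ _]; rewrite /tab_monomial.
rewrite (eq_bigr (fun c => 'X_[if T c is Some k then U_(k)%MM else 0%MM])); last first.
  by move=> c _; case: (T c) => // ; rewrite mpolyX0.
rewrite -(big_morph _ (@mpolyXD N _) (@mpolyX0 N _)); congr mpolyX; apply/mnmP => v.
rewrite mnm_sumE mnmE /cells count_filter -sum1_count big_enum_cond [RHS]big_mkcond /=.
apply: eq_bigr => c _; rewrite -mem_cells -dom /entry.
case: (T c) => [k|] /=; last by rewrite mnm0E andbF.
by rewrite mnm1E andbT -val_eqE; case: eqP.
Qed.

(** Substituting ['X_i ^+ n] for ['X_i] multiplies the content of every tableau by [n], so each
    tableau still contributes a single monomial. *)
Lemma mcoeff_pleth_pn_schur n m :
  ((pleth_pn_schur n N la)@_m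
  = \sum_(T : filling la N | is_ssyt T && ((content T *+ n)%MM == m)) 1)%R.
Proof.
rewrite /pleth_pn_schur /schur (raddf_sum (comp_mpoly _)) (raddf_sum (mcoeff m)) [RHS]big_mkcondr /=.
apply: eq_bigr => T ssT; rewrite tab_monomialE // comp_mpolyX.
rewrite (eq_bigr (fun i => 'X_[U_(i) *+ content T i] ^+ n)%R); last first.
  by move=> i _; rewrite tnth_mktuple -exprM mulnC exprM mpolyXn.
rewrite prodrXl -(big_morph _ (@mpolyXD N _) (@mpolyX0 N _)) mpolyXn mcoeffX.
suff -> : (\sum_(i < N) U_(i) *+ content T i)%MM = content T by case: ifP.
by rewrite -multinomUE_id.
Qed.

Lemma mcoeff_pleth_neq0 n m : ((pleth_pn_schur n N la)@_m != 0)%R ->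
  exists2 T : filling la N, semistandard T & (content T *+ n)%MM = m.
Proof.
rewrite mcoeff_pleth_pn_schur => ne.
have /existsP [T /andP [/is_ssytP ssT /eqP e]] :
    [exists T : filling la N, is_ssyt T && ((content T *+ n)%MM == m)].
  apply: contraNT ne; rewrite negb_exists => /forallP none; rewrite big1 // => T h.
  by have := none T; rewrite h.
by exists T.
Qed.

End Tableaux.

(** This makes every statement on [p_n o s_la] apply to a single Schur polynomial, with [n = 1]; the
    triangularity hypotheses are obtained this way. *)
Lemma pleth_p1_schur N la : pleth_pn_schur 1 N la = schur N la.
Proof.
by rewrite /pleth_pn_schur -[RHS]comp_mpoly_id; congr comp_mpoly.
Qed.

(** * Triangular functionals on Schur expansions *)

Lemma ptrim_surj (mu : seq nat) (d N : nat) :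
  is_partition mu -> sumn mu = d -> (d <= N)%N ->
  exists2 f : {ffun 'I_N -> 'I_d.+1}, nonincr_ffun f & ptrim f = mu.
Proof.
move=> pm sm dN; have fv (i : nat) : (inord (nth 0%N mu i) : 'I_d.+1) = nth 0%N mu i :> nat.
  by rewrite (@inordK d) // ltnS -sm nth_leq_sumn.
exists [ffun i : 'I_N => inord (nth 0%N mu i)].
  apply/forallP => i; apply/forallP => j; apply/implyP => ij.
  by rewrite !ffunE !fv partition_nth_leq.
rewrite /ptrim.
have -> : [seq val ([ffun i : 'I_N => (inord (nth 0%N mu i) : 'I_d.+1)] i) | i <- enum 'I_N]
   = [seq nth 0%N mu i | i <- iota 0 N].
  rewrite -val_enum_ord -map_comp; apply: eq_map => i /=; by rewrite ffunE fv.
have sz : (size mu <= N)%N.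
  by apply: leq_trans dN; rewrite -sm size_leq_sumn //; case/andP: pm.
rewrite -(subnKC sz) iotaD map_cat filter_cat.
have -> : [seq nth 0%N mu i | i <- iota 0 (size mu)] = mu by exact: mkseq_nth.
have /all_filterP -> : all (fun x => 0 < x)%N mu by case/andP: pm.
rewrite -[RHS]cats0; congr cat; apply/eqP; rewrite -(negbK (_ == _)) -has_filter.
apply/hasPn => x /mapP [i]; rewrite mem_iota => h ->; rewrite nth_default //; lia.
Qed.

(** Downward induction on the height [h]. If [L mu F] is nonzero, [P mu] is given. Otherwise the
    nonzero term [c mu * L mu s_mu] must be cancelled by another constituent [nu], which is higher
    by triangularity; [P nu] holds by induction and passes down to [mu]. *)
Lemma schur_expansion_bound (N d H : nat) (F : {mpoly int[N]}) (c : seq nat -> int)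
    (L : seq nat -> {mpoly int[N]} -> int) (h : seq nat -> nat) (P : seq nat -> Prop) :
  (d <= N)%N -> schur_expansion d F c ->
  (forall mu a A B, L mu (a *: A + B) = a * L mu A + L mu B)%R ->
  (forall mu, is_partition mu -> sumn mu = d -> (h mu <= H)%N) ->
  (forall mu, is_partition mu -> sumn mu = d -> L mu (schur N mu) != 0%R) ->
  (forall mu nu, is_partition mu -> sumn mu = d -> is_partition nu -> sumn nu = d ->
     L mu (schur N nu) != 0%R -> nu != mu -> (h mu < h nu)%N /\ (P nu -> P mu)) ->
  (forall mu, is_partition mu -> sumn mu = d -> L mu F != 0%R -> P mu) ->
  forall mu, c mu != 0%R -> P mu.
Proof.
move=> dN [supp expF] lin hH diag tri LF mu.
have L0 nu : L nu 0%R = 0%R.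
  by have := lin nu 1%R 0%R 0%R; rewrite scaler0 addr0 mul1r => /eqP; rewrite eq_sym -subr_eq0 addrK => /eqP.
have LS nu : L nu F = (\sum_(f : {ffun 'I_N -> 'I_d.+1} | nonincr_ffun f)
        c (ptrim f) * L nu (schur N (ptrim f)))%R.
  rewrite expF; elim/big_rec2: _ => [|f A B _ <-]; first exact: L0.
  exact: lin.
have [k] := ubnP (H - h mu); elim: k mu => // k IH mu hk cmu.
have [pm sm] := supp _ cmu.
case: (eqVneq (L mu F) 0%R) => [LF0|]; last exact: LF.
case: (boolP [exists f : {ffun 'I_N -> 'I_d.+1}, [&& nonincr_ffun f, ptrim f != mu,
         c (ptrim f) != 0%R & L mu (schur N (ptrim f)) != 0%R]]).
  case/existsP => f /and4P [_ nm cf Lf]; have [pf sf] := supp _ cf.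
  have [hlt] := tri _ _ pm sm pf sf Lf nm; apply.
  by apply: IH => //; have := hH _ pf sf; lia.
rewrite negb_exists => /forallP none.
have [g ng gm] := ptrim_surj pm sm dN.
move: LF0; rewrite LS (bigID (fun f => ptrim f == mu)) /= [X in (_ + X)%R]big1 ?addr0; last first.
  move=> f /andP [nf fm]; have := none f; rewrite nf fm /= negb_and !negbK.
  by case/orP => /eqP ->; rewrite ?mul0r ?mulr0.
rewrite (eq_bigr (fun=> c mu * L mu (schur N mu))%R); last by move=> f /andP [_ /eqP ->].
rewrite (eq_bigl (mem [pred f | nonincr_ffun f & ptrim f == mu])) // sumr_const.
(* What remains is a nonzero integer repeated once for each [f] that trims to [mu]; it vanishes only
   if no such [f] exists, and [g] is one. *)
move/eqP; rewrite mulrn_eq0 mulf_eq0 (negbTE cmu) (negbTE (diag _ pm sm)) !orbF => /eqP.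
by move/card0_eq/(_ g); rewrite inE ng gm eqxx.
Qed.

(** Converts dominance into a numerical height: the sum of all partial sums grows strictly unless
    the partial sums coincide. *)
Lemma sum_ord_lt_or_eq (f g : nat -> nat) m : (forall k, f k <= g k)%N ->
  (\sum_(k < m) f k < \sum_(k < m) g k)%N \/ (forall k, (k < m)%N -> f k = g k).
Proof.
move=> fg; elim: m => [|m IH]; first by right.
rewrite !big_ord_recr /=.
have le : (\sum_(k < m) f k <= \sum_(k < m) g k)%N by apply: leq_sum.
case: IH => [lt|eqfg]; first by left; rewrite -addSn leq_add.
have := fg m; rewrite leq_eqVlt => /orP [/eqP e|lt]; last by left; rewrite -addnS leq_add.
by right => k; rewrite ltnS leq_eqVlt => /orP [/eqP -> //|]; apply: eqfg.
Qed.

Lemma sumn_take_leq k s : (sumn (take k s) <= sumn s)%N.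
Proof. by rewrite -{2}(cat_take_drop k s) sumn_cat leq_addr. Qed.

Lemma partition_nth_sumn la i : is_partition la -> (sumn la <= i)%N -> nth 0%N la i = 0%N.
Proof.
move=> pl h; rewrite nth_default //; apply: leq_trans _ h.
by apply: size_leq_sumn; case/andP: pl.
Qed.

Lemma sumn_take_inj d mu nu : is_partition mu -> sumn mu = d ->
  is_partition nu -> sumn nu = d ->
  (forall k, (k < d.+1)%N -> sumn (take k mu) = sumn (take k nu)) -> mu = nu.
Proof.
move=> pm sm pn sn e; apply: partition_eq => // i.
have [h|h] := ltnP i d; last by rewrite !partition_nth_sumn ?sm ?sn.
have := e i.+1; rewrite !sumn_take_nthS e ?ltnS //; last exact: ltnW.
by move=> /(_ h) /addnI.
Qed.

(** * Dominance for rows *)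

Section Rows.
Variable N : nat.

Definition row_mon (mu : seq nat) : 'X_{1..N} := [multinom nth 0%N mu v | v < N].

(** Entries start at 0 or more and increase strictly down each column. *)
Lemma row_leq_entry la (T : filling la N) c : is_partition la -> semistandard T ->
  c \in cells la -> (val c.1 <= entry T c)%N.
Proof.
move=> pl ssT; have [k ek] : {k | val c.1 = k} by exists (val c.1).
elim: k c ek => [|k IH] c; first by move=> ->.
rewrite /= => ek cl.
have [|c' cl' [e1 e2]] := @exists_cell la k (val c.2) pl.
  by move: cl; rewrite mem_cells /incell => /leq_trans; apply; apply: partition_nth_leq => //=; lia.
have [_ _ col] := ssT; have := IH _ e1 cl'.
have := col _ _ cl' cl (val_inj e2); rewrite e1 /= in ek *; rewrite /= in e1.
lia.
Qed.

(** Entries below [k] occupy only the first [k] rows, and [n] times their number is the sum of the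
    first [k] parts of [mu]. For [n = 1] this is the triangularity of the Kostka numbers. *)
Lemma sumn_take_leq_content n la mu (T : filling la N) k :
  is_partition la -> semistandard T -> (size mu <= N)%N ->
  (content T *+ n)%MM = row_mon mu -> (sumn (take k mu) <= n * sumn (take k la))%N.
Proof.
move=> pl ssT sz e; rewrite -(count_cells_row (la := la)) //.
apply: (@leq_trans (n * count (fun c => entry T c < k)%N (cells la))); last first.
  rewrite leq_mul2l; apply/orP; right; apply: (@sub_in_count _ _ _ (cells la)).
  by move=> c cl; apply: leq_ltn_trans; apply: row_leq_entry.
elim: k => [|k IH]; first by rewrite take0.
rewrite sumn_take_nthS.
rewrite count_ltnS mulnDr leq_add //; have [kN|kN] := ltnP k N; last by rewrite nth_default //; lia.
have := congr1 (fun m : 'X_{1..N} => m (Ordinal kN)) e.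
by rewrite mulmnE !mnmE /= mulnC => ->.
Qed.

(** The coefficient counts tableaux, and the filling of row [i] by the constant [i] is one of
    them. *)
Lemma mcoeff_row_mon_schur mu : is_partition mu -> (sumn mu <= N)%N ->
  ((schur N mu)@_(row_mon mu) != 0)%R.
Proof.
move=> pm dN; rewrite -pleth_p1_schur mcoeff_pleth_pn_schur.
pose T := @fill mu N (fun c => val c.1).
have lt (c : 'I_(sumn mu) * 'I_(sumn mu)) : (val c.1 < N)%N.
  by move: c => [[i hi] j]; exact: leq_trans hi dN.
have ssT : semistandard T.
  by apply: fill_semistandard => // c c' _ _ ->.
rewrite sumr_const pnatr_eq0 -lt0n; apply/card_gt0P; exists T.
apply/andP; split; first exact/is_ssytP.
apply/eqP/mnmP => v; rewrite mulmnE !mnmE muln1.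
have -> : count (fun c => entry T c == v) (cells mu)
    = count (fun c : 'I_(sumn mu) * 'I_(sumn mu) => val c.1 == val v :> nat) (cells mu).
  by apply: eq_in_count => c cl; rewrite entry_fill.
(* Adding the preceding rows turns the length of row [v] into a difference of partial sums, which
   [count_cells_row] evaluates. *)
apply: (@addnI (sumn (take v mu))); rewrite -sumn_take_nthS -!count_cells_row //.
by rewrite -(count_ltnS (fun c => val c.1)).
Qed.

End Rows.

(** The functional is the coefficient of [x^mu], and the height is the sum of all partial sums of
    [mu]. *)
Lemma pleth_rows_dominance n N la c mu :
  is_partition la -> (n * sumn la <= N)%N ->
  schur_expansion (n * sumn la) (pleth_pn_schur n N la) c -> c mu != 0%R ->
  forall k, (sumn (take k mu) <= n * sumn (take k la))%N.
Proof.
move=> pl dN exp; set d := (n * sumn la)%N in dN exp.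
have sz nu : is_partition nu -> sumn nu = d -> (size nu <= N)%N.
  move=> pn sn; apply: leq_trans dN; rewrite -sn size_leq_sumn //; by case/andP: pn.
apply: (@schur_expansion_bound N d (d.+1 * d) _ c
  (fun mu F => F@_(row_mon N mu))%R (fun mu => \sum_(k < d.+1) sumn (take k mu))%N
  (fun mu => forall k, (sumn (take k mu) <= n * sumn (take k la))%N) dN exp).
- by move=> nu a A B; rewrite mcoeffD mcoeffZ.
- move=> nu pn sn; apply: (@leq_trans (\sum_(k < d.+1) d)); last by rewrite sum_nat_const card_ord.
  by apply: leq_sum => k _; rewrite (leq_trans (sumn_take_leq _ _)) ?sn.
- by move=> nu pn sn; apply: mcoeff_row_mon_schur; rewrite ?sn.
- move=> nu xi pn sn px sx; rewrite -pleth_p1_schur => /mcoeff_pleth_neq0 [T ssT eT] ne.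
  have dom k : (sumn (take k nu) <= sumn (take k xi))%N.
    rewrite -[sumn (take k xi)]mul1n.
    by apply: sumn_take_leq_content eT => //; apply: sz.
  split; last by move=> h k; apply: leq_trans (h k).
  case: (sum_ord_lt_or_eq d.+1 dom) => // e.
  by case/eqP: ne; apply/esym/(sumn_take_inj (d := d)).
- move=> nu pn sn /mcoeff_pleth_neq0 [T ssT eT] k.
  by apply: sumn_take_leq_content eT => //; apply: sz.
Qed.

(** * Standardization *)

Section Standardization.
Variables (la : seq nat) (N : nat).
Hypothesis pl : is_partition la.
Local Notation cell := ('I_(sumn la) * 'I_(sumn la))%type.
Implicit Types (c : cell) (S : filling la (sumn la)) (T : filling la N) (a : cell -> nat).

Definition standard S : Prop :=
  semistandard S /\ {in cells la &, injective (entry S)}.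

(** The entries are distinct and lie in a range with as many values as there are cells. *)
Lemma standard_perm S : standard S ->
  perm_eq [seq entry S c | c <- cells la] (iota 0 (sumn la)).
Proof.
move=> [ss inj].
have u : uniq [seq entry S c | c <- cells la] by rewrite map_inj_in_uniq ?cells_uniq.
apply: uniq_perm => //; first exact: iota_uniq.
have sub : {subset [seq entry S c | c <- cells la] <= iota 0 (sumn la)}.
  by move=> x /mapP [c cl ->]; rewrite mem_iota /= add0n entry_lt.
have [] // := uniq_min_size u sub.
by rewrite size_iota size_map size_cells.
Qed.

Lemma count_standard S (Q : pred nat) : standard S ->
  count (fun c => Q (entry S c)) (cells la) = count Q (iota 0 (sumn la)).
Proof. by move=> /standard_perm /permP /(_ Q) <-; rewrite count_map. Qed.

Lemma standard_cell S p : standard S -> (p < sumn la)%N ->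
  exists2 c, c \in cells la & entry S c = p.
Proof.
move=> /standard_perm /perm_mem e pe.
have : p \in [seq entry S c | c <- cells la] by rewrite e mem_iota.
by case/mapP => c cl ->; exists c.
Qed.

(** The standardization order: ties go to the lower row first, then from left to right. Equal
    entries of a semistandard tableau form a horizontal strip, on which this is the order from left
    to right. *)
Definition before a c c' : bool :=
  (a c < a c')%N || (a c == a c') &&
    ((val c'.1 < val c.1)%N || (val c.1 == val c'.1) && (val c.2 < val c'.2)%N).

Definition rank a c : nat := count (before a ^~ c) (cells la).

Lemma before_irr a c : before a c c = false.
Proof. by rewrite /before; lia. Qed.

Lemma before_trans a : transitive (before a).
Proof. by move=> c1 c0 c2; rewrite /before; lia. Qed.

Lemma cell_neq c c' : c != c' -> (val c.1 != val c'.1) || (val c.2 != val c'.2).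
Proof. by case: c c' => [i j] [i' j']; rewrite xpair_eqE negb_and. Qed.

Lemma before_total a c c' : c != c' -> before a c c' || before a c' c.
Proof.
by move=> /cell_neq; rewrite /before; lia.
Qed.

Lemma rank_lt a c : c \in cells la -> (rank a c < sumn la)%N.
Proof.
move=> cl; rewrite -size_cells // -count_predT.
by apply: (sub_in_count_lt (x := c)) => //; rewrite before_irr.
Qed.

Lemma before_rank a c c' : c \in cells la -> before a c c' -> (rank a c < rank a c')%N.
Proof.
move=> cl h; apply: (sub_in_count_lt (x := c)) => //; last by rewrite before_irr.
by move=> c0 _ h0; apply: before_trans h.
Qed.

Lemma eq_rank a a' : {in cells la, a =1 a'} -> {in cells la, rank a =1 rank a'}.
Proof. by move=> e c cl; apply: eq_in_count => c' cl'; rewrite /before !e. Qed.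

Variable phi : nat -> nat.
Hypothesis phi_mono : forall p q, (p <= q)%N -> (phi p <= phi q)%N.
Hypothesis phiN : forall p, (p < sumn la)%N -> (phi p < N)%N.

(* No descent of [S] inside a fibre of [phi]. *)
Definition adapted S : Prop :=
  {in cells la &, forall c c', entry S c' = (entry S c).+1 ->
     phi (entry S c) = phi (entry S c') -> (val c'.1 <= val c.1)%N}.

(** The content is given by the fibre sizes of [phi], so the fibres of a monotone [phi] are the
    blocks of consecutive labels that standardization assigns to equal entries. *)
Definition has_phi_content T : Prop :=
  forall v, count (fun c => entry T c == v) (cells la)
          = count (fun p => phi p == v) (iota 0 (sumn la)).

Definition standardize T : filling la (sumn la) := fill (sumn la) (rank (entry T)).
Definition relabel S : filling la N := fill N (fun c => phi (entry S c)).

Lemma adapted_chain S : standard S -> adapted S ->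
  {in cells la &, forall c c', (entry S c < entry S c')%N ->
     phi (entry S c) = phi (entry S c') -> (val c'.1 <= val c.1)%N}.
Proof.
move=> st ad c c' cl cl' lt; have ek : entry S c' = (entry S c + (entry S c' - (entry S c).+1).+1)%N by lia.
move: (entry S c' - _)%N ek => k; elim: k c' cl' {lt} => [|k IH] c' cl' ek ephi.
  by apply: ad => //; lia.
have lt' : (entry S c' < sumn la)%N by apply: entry_lt => //; case: st.
have [|c0 cl0 e0] := @standard_cell S (entry S c + k.+1) st; first by lia.
have h1 : (phi (entry S c) <= phi (entry S c0))%N by apply: phi_mono; lia.
have h2 : (phi (entry S c0) <= phi (entry S c'))%N by apply: phi_mono; lia.
apply: (@leq_trans (val c0.1)); last by apply: IH => //; lia.
by apply: ad => //; lia.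
Qed.

Lemma entry_relabel S : standard S -> {in cells la, forall c, entry (relabel S) c = phi (entry S c)}.
Proof. by move=> [ss _] c cl; rewrite entry_fill // phiN // entry_lt. Qed.

(** Two cells of one column could only receive the same label inside a fibre of [phi], where larger
    entries never lie in lower rows. *)
Lemma relabel_semistandard S : standard S -> adapted S -> semistandard (relabel S).
Proof.
move=> st ad; have [ss inj] := st; have [_ row col] := ss.
apply: fill_semistandard => [c cl|c c' cl cl' e l|c c' cl cl' e l].
- by rewrite phiN // entry_lt.
- by apply: phi_mono; apply: row.
have lt := col _ _ cl cl' e l.
have := phi_mono (ltnW lt); rewrite leq_eqVlt => /orP [/eqP ephi|//].
by have := adapted_chain st ad cl cl' lt ephi; rewrite /= leqNgt l.
Qed.

Lemma relabel_content S : standard S -> has_phi_content (relabel S).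
Proof.
move=> st v; rewrite -(count_standard (fun p => phi p == v) st).
by apply: eq_in_count => c cl; rewrite entry_relabel.
Qed.

(** Breaking ties in the relabelled tableau restores the order of the entries of [S]. One
    implication suffices, since [before] is transitive and irreflexive and [S] is injective. *)
Lemma before_relabel S : standard S -> adapted S ->
  {in cells la &, forall c c', before (fun c => phi (entry S c)) c c' = (entry S c < entry S c')%N}.
Proof.
move=> st ad.
have h : {in cells la &, forall c c', (entry S c < entry S c')%N -> before (fun c => phi (entry S c)) c c'}.
  move=> c c' cl cl' lt; have [[_ row _] _] := st.
  have := phi_mono (ltnW lt); rewrite /before leq_eqVlt => /orP [/eqP ephi|->//].
  (* Inside a fibre the larger entry lies weakly higher; if the rows agree, row monotonicity decides
     the columns. *)
  have := adapted_chain st ad cl cl' lt ephi; rewrite leq_eqVlt => /orP [/eqP e1|l1]; last by lia.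
  have ne : c != c' by apply: contraTneq lt => ->; rewrite ltnn.
  have l2 : (val c.2 <= val c'.2)%N.
    by rewrite leqNgt; apply/negP => /(row _ _ cl' cl (val_inj e1)); lia.
  by have := cell_neq ne; move: e1 l2; rewrite /= ephi ltnn eqxx /=; lia.
move=> c c' cl cl'; apply/idP/idP; last exact: h.
case: (ltngtP (entry S c) (entry S c')) => // [lt b|e].
  by have := before_trans b (h _ _ cl' cl lt); rewrite before_irr.
by have [_ inj] := st; rewrite (inj _ _ cl cl' e) before_irr.
Qed.

Lemma relabelK S : standard S -> adapted S -> standardize (relabel S) = S.
Proof.
move=> st ad; have [ss _] := st.
have rk : {in cells la, forall c, rank (entry (relabel S)) c = entry S c}.
  move=> c cl; rewrite (eq_rank (entry_relabel st)) // /rank.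
  rewrite (eq_in_count (a2 := fun c' => (entry S c' < entry S c)%N)).
    rewrite (count_standard (fun p => p < entry S c)%N st) count_iota_ltn.
    by have := entry_lt cl ss; lia.
  by move=> c' cl'; apply: before_relabel.
have e : {in cells la, entry (standardize (relabel S)) =1 entry S}.
  by move=> c cl; rewrite entry_fill // rk // entry_lt.
apply/ffunP => c; have [dom _ _] := ss; move: (e c) (dom c); rewrite /entry /standardize ffunE.
case: ifP => cl; last by move=> _; case: (S c).
rewrite insubT /= ?rank_lt // => p; case: (S c) => [x|//] /= /(_ isT) ex _.
by congr Some; apply: val_inj.
Qed.

Section FromContent.
Variable T : filling la N.
Hypothesis ssT : semistandard T.
Hypothesis contT : has_phi_content T.

Lemma entry_standardize : {in cells la, forall c, entry (standardize T) c = rank (entry T) c}.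
Proof. by move=> c cl; rewrite entry_fill // rank_lt. Qed.

Lemma count_entry_phi v : count (fun c => entry T c < v)%N (cells la)
  = count (fun p => phi p < v)%N (iota 0 (sumn la)).
Proof.
elim: v => [|v IH]; last by rewrite !count_ltnS IH contT.
by rewrite !(eq_count (a2 := pred0)) ?count_pred0.
Qed.

(** The rank of [c] is at least the number of entries smaller than that of [c] and less than the
    number of entries not exceeding it. These two counts delimit the fibre of [phi] over the entry,
    because [phi] is monotone. *)
Lemma phi_rank : {in cells la, forall c, phi (rank (entry T) c) = entry T c}.
Proof.
move=> c cl; have down v : {in gtn (sumn la) &, forall p q, (p <= q)%N -> (phi q < v)%N -> (phi p < v)%N}.
  by move=> p q _ _ pq; apply: leq_ltn_trans; apply: phi_mono.
have rl := rank_lt (entry T) cl.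
have h1 := count_iota_downclosed (down (entry T c)) rl.
have h2 := count_iota_downclosed (down (entry T c).+1) rl.
rewrite -!count_entry_phi in h1 h2.
have : (rank (entry T) c < count (fun c' => entry T c' < (entry T c).+1)%N (cells la))%N.
  apply: (sub_in_count_lt (x := c)) => //; last by rewrite before_irr.
  by move=> c' _; rewrite /before; lia.
have : (count (fun c' => entry T c' < entry T c)%N (cells la) <= rank (entry T) c)%N.
  by apply: sub_in_count => c' _; rewrite /before => ->.
by rewrite h2 leqNgt h1; lia.
Qed.

Lemma standardize_standard : standard (standardize T).
Proof.
have [_ row col] := ssT; split.
  apply: fill_semistandard => [c cl|c c' cl cl' e l|c c' cl cl' e l]; first exact: rank_lt.
    apply/ltnW/before_rank => //; have := row _ _ cl cl' e l; rewrite /before e /=.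
    by rewrite eqxx /= in l *; lia.
  by apply/before_rank => //; have := col _ _ cl cl' e l; rewrite /before => ->.
move=> c c' cl cl'; rewrite !entry_standardize // => e; apply/eqP; case: eqVneq => // ne.
by case/orP: (before_total (entry T) ne) => /before_rank; rewrite e ltnn => ->.
Qed.

(** Between equal entries of [T], a descent would contradict the rule that lower rows come first. *)
Lemma standardize_adapted : adapted (standardize T).
Proof.
move=> c c' cl cl'; rewrite !entry_standardize // !phi_rank // => er et.
have nb : ~~ before (entry T) c' c by apply/negP => /(before_rank cl'); lia.
by move: nb; rewrite /before et; lia.
Qed.

Lemma standardizeK : relabel (standardize T) = T.
Proof.
apply: entry_inj => //.
  exact: relabel_semistandard standardize_standard standardize_adapted.
by move=> c cl; rewrite entry_relabel ?entry_standardize ?phi_rank //; apply: standardize_standard.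
Qed.

End FromContent.

(** [relabel] and [standardize] are mutually inverse between the two sets. *)
Lemma card_standardization (A : pred (filling la (sumn la))) (B : pred (filling la N)) :
  (forall S, reflect (standard S /\ adapted S) (A S)) ->
  (forall T, reflect (semistandard T /\ has_phi_content T) (B T)) ->
  #|B| = #|A|.
Proof.
move=> AP BP; have inj : {in A &, injective relabel}.
  by apply: (can_in_inj (g := standardize)) => S /AP [st ad]; apply: relabelK.
rewrite -(card_in_imset inj) -[LHS]cardsE; apply: eq_card => T; rewrite !inE.
apply/idP/imsetP => [/BP [ssT cT]|[S /AP [st ad] ->]].
  exists (standardize T); last by rewrite standardizeK.
  by apply/AP; split; [apply: standardize_standard|apply: standardize_adapted].
by apply/BP; split; [apply: relabel_semistandard|apply: relabel_content].
Qed.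

End Standardization.

(** * Signed sums over refinements *)

(** If some [x] lies in [Y] but not in [X], toggling [x] is a sign-reversing involution of the
    interval, so the sum equals its own negative. *)
Lemma signed_sum_interval (I : finType) (X Y : {set I}) :
  (\sum_(D : {set I} | (X \subset D) && (D \subset Y)) (-1) ^+ #|D| : int)%R
  = (if X == Y then (-1) ^+ #|Y| else 0)%R.
Proof.
case: eqVneq => [->|ne].
  by rewrite (big_pred1 Y) // => D; rewrite /= eqEsubset andbC.
case: (boolP (X \subset Y)) => [sXY|nXY]; last first.
  by rewrite big_pred0 // => D; apply: contraNF nXY => /andP [h1 h2]; apply: subset_trans h2.
have [x xY xX] : exists2 x, x \in Y & x \notin X.
  by apply/subsetPn; apply: contra ne => h; rewrite eqEsubset sXY.
pose tog (D : {set I}) := if x \in D then D :\ x else x |: D.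
have togK : involutive tog.
  move=> D; rewrite /tog; case: (boolP (x \in D)) => h.
    by rewrite setD11 setD1K.
  by rewrite setU11 setU1K.
set s := (\sum_(D | _) _)%R; suff : (s = - s)%R by lia.
rewrite {1}/s (reindex_inj (inv_inj togK)) -sumrN /=.
apply: eq_big => D.
  rewrite /tog; case: ifP => h.
    rewrite subsetD1 xX andbT; case: (X \subset D) => //=.
    by rewrite subDset (setUidPr _) // sub1set.
  rewrite subUset sub1set xY /=; congr andb.
  apply/idP/idP => [|/subset_trans]; last by apply; apply: subsetUr.
  move=> sub; apply/subsetP => y yX; have := subsetP sub _ yX; rewrite !inE.
  by case/orP => // /eqP yx; rewrite -yx yX in xX.
move=> _; rewrite /tog; case: ifP => h.
  by rewrite [in RHS](cardsD1 x) h exprS mulN1r opprK.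
by rewrite cardsU1 h exprS mulN1r.
Qed.

(** The start of the block containing position [p] when the positions are cut at [D]; position 0
    always starts a block. *)
Fixpoint last_cut (D : pred nat) (p : nat) : nat :=
  if p is p'.+1 then if D p then p else last_cut D p' else 0%N.

Lemma last_cut_leq D p : (last_cut D p <= p)%N.
Proof. by elim: p => //= p IH; case: ifP => // _; apply: leqW. Qed.

Lemma last_cut_id (D : pred nat) q : D q -> last_cut D q = q.
Proof. by case: q => //= q ->. Qed.

Lemma last_cut_mono D p q : (p <= q)%N -> (last_cut D p <= last_cut D q)%N.
Proof.
move=> pq; rewrite -(subnKC pq); elim: (q - p)%N => [|k IH]; rewrite ?addn0 // addnS /=.
by case: ifP => // _; apply: (leq_trans IH); apply/leqW/last_cut_leq.
Qed.

(** A block never crosses a cut [q], so its start lies on the same side of [q] as each of its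
    positions. *)
Lemma last_cut_lt (D : pred nat) p q : D q -> (last_cut D p < q)%N = (p < q)%N.
Proof.
move=> Dq; apply/idP/idP; last exact: leq_ltn_trans (last_cut_leq D p).
by rewrite !ltnNge; apply: contra => /(last_cut_mono D); rewrite last_cut_id.
Qed.

Lemma last_cut_const D p q : (p <= q)%N -> (forall x, (p < x <= q)%N -> ~~ D x) ->
  last_cut D q = last_cut D p.
Proof.
move=> pq; rewrite -(subnKC pq); elim: (q - p)%N => [|k IH] nD; rewrite ?addn0 // addnS /=.
rewrite ifN; last by apply: nD; lia.
by apply: IH => x h; apply: nD; lia.
Qed.

Section SignedCoefficient.
Variables (N d : nat).
Hypothesis dN : (d <= N)%N.
Implicit Types D B : {set 'I_d}.

Definition cut D : pred nat := fun p => [exists i in D, val i == p].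

Lemma cutP D p : reflect (exists2 i, i \in D & val i = p) (cut D p).
Proof. by apply: (iffP exists_inP) => -[i iD /eqP e]; exists i => //; apply/eqP. Qed.

Lemma cut_val D i : cut D (val i) = (i \in D).
Proof.
apply/cutP/idP => [[j jD /val_inj <-] //|iD]; by exists i.
Qed.

(* The part of the composition starting at position [q] is attached to the
   variable [q], so refining a composition changes no other exponent. *)
Definition cut_mon D : 'X_{1..N} :=
  [multinom count (fun p => last_cut (cut D) p == v) (iota 0 d) | v < N].

(** The sets [D] containing [B] encode the refinements of the composition cut at [B]. When 0 is in
    [B] the number of parts is [#|D|], so on symmetric polynomials of degree [d] this is the pairing
    with [e_beta] up to a global sign. *)
Definition signed_coeff B (F : {mpoly int[N]}) : int :=
  (\sum_(D : {set 'I_d} | B \subset D) (-1) ^+ #|D| * F@_(cut_mon D))%R.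

Lemma signed_coeff_linear B a F G :
  (signed_coeff B (a *: F + G) = a * signed_coeff B F + signed_coeff B G)%R.
Proof.
rewrite /signed_coeff mulr_sumr -big_split /=; apply: eq_bigr => D _.
by rewrite mcoeffD mcoeffZ mulrDr mulrCA.
Qed.

Lemma count_last_cut D v :
  count (fun p => last_cut (cut D) p == v) (iota 0 d)
  = if insub v is Some i then cut_mon D i else 0%N.
Proof.
case: insubP => [i _ <-|vN]; first by rewrite mnmE.
rewrite (eq_in_count (a2 := pred0)) ?count_pred0 // => p; rewrite mem_iota => h.
by have := last_cut_leq (cut D) p; case: eqP => //; lia.
Qed.

Variables (n : nat) (la : seq nat).
Hypotheses (n0 : (0 < n)%N) (pl : is_partition la) (dE : d = (n * sumn la)%N).

Definition multiples : {set 'I_d} := [set q : 'I_d | n %| q]%N.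

Lemma cut_dvd D q : D \subset multiples -> cut D q -> (n %| q)%N.
Proof. by move=> /subsetP sub /cutP [i /sub]; rewrite inE => h <-. Qed.

(** For a cut [q], the exponents of the variables below [q] add up to [q], and each of them is
    divisible by [n]. *)
Lemma content_cut_mon_multiples D (T : filling la N) :
  (content T *+ n)%MM = cut_mon D -> D \subset multiples.
Proof.
move=> e; apply/subsetP => q qD; rewrite inE.
have dv w : (n %| count (fun p => last_cut (cut D) p < w)%N (iota 0 d))%N.
  elim: w => [|w IH]; first by rewrite (eq_count (a2 := pred0)) ?count_pred0.
  rewrite count_ltnS dvdn_add // count_last_cut -e; case: insub => // i.
  by rewrite mulmnE dvdn_mull.
have := dv q; rewrite (eq_count (a2 := fun p => p < q)%N); last first.
  by move=> p; rewrite last_cut_lt // cut_val.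
by rewrite count_iota_ltn (minn_idPl _) // ltnW.
Qed.

(** The block map rescaled by [n]; it plays the part of [phi] when tableaux of shape [la] are
    standardized. *)
Definition fibre_cut D p := last_cut (cut D) (n * p).

Lemma fibre_cut_mono D p q : (p <= q)%N -> (fibre_cut D p <= fibre_cut D q)%N.
Proof. by move=> pq; apply: last_cut_mono; rewrite leq_mul2l pq orbT. Qed.

Lemma fibre_cut_lt D p : (p < sumn la)%N -> (fibre_cut D p < N)%N.
Proof.
move=> pe; apply: leq_trans dN; rewrite dE; apply: leq_ltn_trans (last_cut_leq _ _) _.
by rewrite ltn_pmul2l.
Qed.

Lemma last_cut_multiples D p : D \subset multiples -> last_cut (cut D) p = fibre_cut D (p %/ n).
Proof.
move=> sub; apply: last_cut_const; first by rewrite mulnC leq_divM.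
move=> x h; apply/negP => /(cut_dvd sub) /dvdnP [k xk]; subst x.
have : (p %/ n < k)%N by move: (proj1 (andP h)); rewrite mulnC ltn_pmul2r.
by rewrite ltn_divLR //; lia.
Qed.

(** All cuts are multiples of [n], so the [n] positions with a given quotient share a block, and the
    factor [n] cancels from both counts. *)
Lemma content_cut_monP D (T : filling la N) : D \subset multiples -> semistandard T ->
  reflect (has_phi_content (fibre_cut D) T) ((content T *+ n)%MM == cut_mon D).
Proof.
move=> sub ssT.
have cnt v : count (fun p => last_cut (cut D) p == v) (iota 0 d)
    = (n * count (fun p => fibre_cut D p == v) (iota 0 (sumn la)))%N.
  rewrite dE -(count_iota_divn (fun p => fibre_cut D p == v)) //; apply: eq_count => p.
  by rewrite last_cut_multiples.
apply: (iffP eqP) => [e v|h]; last first.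
  by apply/mnmP => v; rewrite mulmnE !mnmE h cnt mulnC.
have [vN|vN] := ltnP v N.
  have := congr1 (fun m : 'X_{1..N} => m (Ordinal vN)) e.
  rewrite mulmnE !mnmE /= cnt mulnC => /eqP; rewrite eqn_pmul2l //; exact/eqP.
(* For [v] at least [N] both counts are zero, as entries and block starts stay below [N]. *)
rewrite !(eq_in_count (a2 := pred0)) ?count_pred0 // => x.
  by rewrite mem_iota => h; have := @fibre_cut_lt D x; case: eqP => //; lia.
by move=> xl; have := entry_lt xl ssT; case: eqP => //; lia.
Qed.

Definition is_standard (S : filling la (sumn la)) : bool :=
  is_ssyt S && [forall c, forall c',
    [&& c \in cells la, c' \in cells la & entry S c == entry S c'] ==> (c == c')].

Lemma is_standardP S : reflect (standard S) (is_standard S).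
Proof.
apply: (iffP andP) => [[/is_ssytP ss /forallP inj]|[ss inj]]; split => //.
- move=> c c' cl cl' e; have /forallP /(_ c') := inj c.
  by rewrite cl cl' e eqxx => /eqP.
- exact/is_ssytP.
apply/forallP => c; apply/forallP => c'; apply/implyP => /and3P [cl cl' /eqP e].
by apply/eqP/inj.
Qed.

(** A descent from [p] to [p.+1] is recorded at [n * p.+1], the position where a new block has to
    start. *)
Definition descents (S : filling la (sumn la)) : {set 'I_d} :=
  [set q : 'I_d | [exists c, exists c', [&& c \in cells la, c' \in cells la,
     entry S c' == (entry S c).+1, val q == (n * entry S c')%N & val c.1 < val c'.1]]]%N.

(** Since all cuts are multiples of [n], the values [p] and [p.+1] lie in different fibres exactly
    when [n * p.+1] is a cut. *)
Lemma adaptedP D S : D \subset multiples -> standard S ->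
  reflect (adapted (fibre_cut D) S) (descents S \subset D).
Proof.
move=> sub st; apply: (iffP subsetP) => [ds c c' cl cl' e1 e2|ad q].
  rewrite leqNgt; apply/negP => lt.
  have qd : (n * entry S c' < d)%N.
    by rewrite dE ltn_pmul2l //; apply: entry_lt => //; case: st.
  have /ds : Ordinal qd \in descents S.
    rewrite inE; apply/existsP; exists c; apply/existsP; exists c'.
    by apply/and5P; split; rewrite ?e1 ?eqxx.
  rewrite -cut_val => /last_cut_id /= e3.
  have := last_cut_leq (cut D) (n * entry S c).
  by move: e2; rewrite /fibre_cut e3 e1 mulnS => ->; lia.
rewrite inE => /existsP [c /existsP [c' /and5P [cl cl' /eqP e1 /eqP eq lt]]].
apply/negPn/negP => qD; move: lt; rewrite ltnNge ad // /fibre_cut.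
apply/esym/last_cut_const; first by rewrite leq_mul2l; lia.
move=> x h; apply/negP => xD; have /dvdnP [k xk] := cut_dvd sub xD.
move: qD; rewrite -cut_val eq; suff -> : entry S c' = k by rewrite mulnC -xk xD.
subst x; move: h; rewrite mulnC (mulnC n) ltn_pmul2r // leq_pmul2r // e1; lia.
Qed.

Lemma mcoeff_cut_mon D :
  ((pleth_pn_schur n N la)@_(cut_mon D) = if D \subset multiples then
     #|[pred S | is_standard S && (descents S \subset D)]|%:R else 0)%R.
Proof.
rewrite mcoeff_pleth_pn_schur; case: ifPn => sub; last first.
  rewrite big_pred0 // => T; apply/negP => /andP [_ /eqP /content_cut_mon_multiples].
  by apply/negP.
rewrite (eq_bigl (mem [pred T : filling la N | is_ssyt T & (content T *+ n)%MM == cut_mon D])) //.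
rewrite sumr_const; congr (_ *+ _)%R.
apply: (card_standardization pl (@fibre_cut_mono D) (@fibre_cut_lt D)) => [S|T].
  apply: (iffP andP) => [[/is_standardP st /(adaptedP sub st)]|[st /(adaptedP sub st)]] //.
  by split=> //; apply/is_standardP.
apply: (iffP andP) => [[/is_ssytP ss /(content_cut_monP sub ss)]|[ss /(content_cut_monP sub ss)]] //.
by split=> //; apply/is_ssytP.
Qed.

(** After exchanging the sums, a fixed [S] sees the sets [D] between [B :|: descents S] and
    [multiples]. The signed sum keeps only the case of equality, always with the same sign, so no
    cancellation remains among tableaux. *)
Lemma signed_coeff_pleth B : (signed_coeff B (pleth_pn_schur n N la) =
  (-1) ^+ #|multiples| *+ #|[pred S | is_standard S && (B :|: descents S == multiples)]|)%R.
Proof.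
rewrite /signed_coeff (eq_bigr (fun D => if D \subset multiples then
   \sum_(S | is_standard S && (descents S \subset D)) (-1) ^+ #|D| else 0)%R); last first.
  move=> D _; rewrite mcoeff_cut_mon; case: ifP => _; rewrite ?mulr0 //.
  rewrite (eq_bigl (mem [pred S | is_standard S && (descents S \subset D)])) //.
  by rewrite sumr_const mulr_natr.
rewrite -big_mkcondr (exchange_big_dep is_standard) /=; last by move=> D S _ /andP [].
rewrite (eq_bigr (fun S => if B :|: descents S == multiples then (-1) ^+ #|multiples| else 0)%R).
  rewrite -big_mkcondr -sumr_const; exact: eq_bigl.
move=> S st; rewrite -signed_sum_interval; apply: eq_bigl => D.
by rewrite subUset st /= andbAC.
Qed.

End SignedCoefficient.

(** * The column functional *)

(** The partial sums of the conjugate partition, starting with 0. For a partition of [d], those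
    below [d] all come from indices below [d]. *)
Definition col_cuts (d : nat) (mu : seq nat) : {set 'I_d} :=
  [set q : 'I_d | [exists j : 'I_d, val q == colsum j mu]].

Section Cover.
Variables (d n : nat) (la mu : seq nat) (S : filling la (sumn la)).
Hypotheses (n0 : (0 < n)%N) (pl : is_partition la) (dE : d = (n * sumn la)%N).
Hypothesis st : standard S.
Hypothesis cover : col_cuts d mu :|: descents d n S = multiples d n.

Lemma row_lt_succ k m c c' : c \in cells la -> c' \in cells la ->
  (colsum k mu <= n * m)%N -> (n * entry S c' < colsum k.+1 mu)%N ->
  (m <= entry S c)%N -> entry S c' = (entry S c).+1 -> (val c.1 < val c'.1)%N.
Proof.
move=> cl cl' lo hi mc e; have [ss inj] := st.
have qd : (n * entry S c' < d)%N by rewrite dE ltn_pmul2l // entry_lt.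
have : Ordinal qd \in multiples d n by rewrite inE /= dvdn_mulr.
(* This multiple of [n] lies strictly between two consecutive column sums, so it is no cut and must
   come from a descent. *)
rewrite -cover inE => /orP []; rewrite inE.
  case/existsP => j /eqP /= ej.
  have lt : (n * m < n * entry S c')%N by rewrite ltn_pmul2l // e ltnS.
  have [jk|kj] := leqP j k; first by have := leq_colsum mu jk; lia.
  by have := leq_colsum mu kj; lia.
case/existsP => c0 /existsP [c1 /and5P [cl0 cl1 /eqP e0 /eqP /= eq lt]].
have e1 : entry S c1 = entry S c'.
  by apply/eqP; rewrite -(eqn_pmul2l n0) -eq.
by rewrite -(inj _ _ cl1 cl' e1) -(inj _ _ cl0 cl) //; lia.
Qed.

(** Within one block every successive value is a descent, so the rows increase strictly along the
    whole block. *)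
Lemma row_lt_between_cuts k c c' : c \in cells la -> c' \in cells la ->
  (colsum k mu <= n * entry S c)%N -> (n * entry S c' < colsum k.+1 mu)%N ->
  (entry S c < entry S c')%N -> (val c.1 < val c'.1)%N.
Proof.
move=> cl cl' lo hi lt.
have [m em] : {m | entry S c' = (entry S c + m.+1)%N} by exists (entry S c' - (entry S c).+1)%N; lia.
elim: m c' cl' hi em {lt} => [|m IH] c' cl' hi em.
all: have lt' : (entry S c' < sumn la)%N by apply: entry_lt => //; case: st.
all: have [|c0 cl0 e0] := @standard_cell la pl S (entry S c').-1 st; first by lia.
all: have step : (val c0.1 < val c'.1)%N by apply: (row_lt_succ cl0 cl' lo hi); lia.
- suff <- : c0 = c by [].
  by have [_ inj] := st; apply: inj => //; lia.
apply: ltn_trans step; apply: IH => //; last by lia.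
by apply: leq_ltn_trans hi; rewrite leq_mul2l; lia.
Qed.

(** The left neighbour has a smaller entry in the same row. It cannot share the block of [c], where
    rows increase strictly, so it belongs to an earlier block and the induction applies. *)
Lemma col_lt_of_entry k c : c \in cells la -> (n * entry S c < colsum k mu)%N ->
  (val c.2 < k)%N.
Proof.
elim: k c => [|k IH] c cl; first by rewrite colsum0.
move=> hi; have [j0|j0] := posnP (val c.2); first by rewrite j0.
have [|c' cl' [e1 e2]] := @exists_cell la (val c.1) (val c.2).-1 pl.
  by move: cl; rewrite mem_cells /incell; apply: leq_ltn_trans; apply: leq_pred.
have lt : (entry S c' < entry S c)%N.
  have [[_ row _] inj] := st; rewrite ltn_neqAle row // ?e2 ?ltn_predL // ?andbT.
    by apply/eqP => /(inj _ _ cl' cl) ec; move: e2 j0; rewrite ec; lia.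
  exact: val_inj.
have [h|h] := ltnP (n * entry S c') (colsum k mu).
  by have := IH _ cl' h; rewrite e2; lia.
by have := row_lt_between_cuts cl' cl h hi lt; rewrite e1 ltnn.
Qed.

Lemma colsum_leq_of_cover k : (sumn mu <= d)%N -> (colsum k mu <= n * colsum k la)%N.
Proof.
move=> md; rewrite leqNgt; apply/negP => gt.
have lt : (colsum k la < sumn la)%N.
  by rewrite -(ltn_pmul2l n0) -dE; apply: (leq_trans gt); apply: leq_trans (colsum_leq_sumn _ _) md.
have : (count (fun c => n * entry S c < colsum k mu)%N (cells la) <= colsum k la)%N.
  by rewrite -(count_cells_col (la := la)) //; apply: sub_in_count => c cl; apply: col_lt_of_entry.
rewrite (count_standard pl (fun p => n * p < colsum k mu)%N st) leqNgt => /negP; apply.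
(* If the bound failed, the values from 0 to [colsum k la] would all have to lie in the first [k]
   columns of [la], one more than there are cells. *)
have := count_iota_ltn (colsum k la).+1 (sumn la); rewrite (minn_idPl lt) => {1}<-.
apply: sub_in_count => p _ pk; apply: leq_ltn_trans gt.
by rewrite leq_mul2l -ltnS pk orbT.
Qed.

End Cover.

Lemma colsum_leq_of_signed_coeff N d n la mu : (0 < n)%N -> is_partition la ->
  d = (n * sumn la)%N -> (d <= N)%N -> (sumn mu <= d)%N ->
  (signed_coeff (col_cuts d mu) (pleth_pn_schur n N la) != 0)%R ->
  forall k, (colsum k mu <= n * colsum k la)%N.
Proof.
move=> n0 pl dE dN md; rewrite signed_coeff_pleth // => ne k.
move: ne; rewrite mulrn_eq0 negb_or -lt0n => /andP [/card_gt0P [S]].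
rewrite inE => /andP [/is_standardP st /eqP cover] _.
exact: (colsum_leq_of_cover n0 pl dE st cover).
Qed.

(* The column reading tableau of shape [mu] is cut exactly at the columns. *)
Lemma signed_coeff_schur_neq0 N d mu : is_partition mu -> d = sumn mu -> (d <= N)%N ->
  (signed_coeff (col_cuts d mu) (schur N mu) != 0)%R.
Proof.
move=> pm dE dN; have dE1 : d = (1 * sumn mu)%N by rewrite mul1n.
rewrite -pleth_p1_schur signed_coeff_pleth // mulrn_eq0 signr_eq0 orbF -lt0n.
(* Columns are filled from left to right, each from top to bottom. *)
pose f (c : 'I_(sumn mu) * 'I_(sumn mu)) := (colsum (val c.2) mu + val c.1)%N.
have fS c : c \in cells mu -> (f c < colsum (val c.2).+1 mu)%N.
  by rewrite mem_cells /incell => h; rewrite colsumS ltn_add2l partition_nth_count.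
have flt c : c \in cells mu -> (f c < sumn mu)%N.
  by move/fS => h; apply: leq_trans h (colsum_leq_sumn _ _).
have fcol c c' : c \in cells mu -> (val c.2 < val c'.2)%N -> (f c < f c')%N.
  move=> /fS h l; apply: leq_trans h _; apply: leq_trans (leq_addr _ _).
  exact: leq_colsum.
have e : {in cells mu, forall c, entry (fill (sumn mu) f) c = f c}.
  by move=> c cl; rewrite entry_fill ?flt.
have st : standard (fill (sumn mu) f).
  split.
    apply: fill_semistandard => // [c c' cl cl' _ l|c c' cl cl' el l].
      exact/ltnW/fcol.
    by rewrite /f el ltn_add2l.
  move=> c c' cl cl'; rewrite !e // => ef.
  have e2 : val c.2 = val c'.2.
    case: (ltngtP (val c.2) (val c'.2)) => // l.
      by have := fcol _ _ cl l; rewrite ef ltnn.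
    by have := fcol _ _ cl' l; rewrite ef ltnn.
  move: ef; rewrite /f e2 => /addnI e1.
  by case: c c' e1 e2 {cl cl'} => [i j] [i' j'] /= /val_inj -> /val_inj ->.
apply/card_gt0P; exists (fill (sumn mu) f); rewrite inE; apply/andP; split.
  exact/is_standardP.
apply/eqP/setP => q; rewrite !inE dvd1n.
have qs : (val q < sumn mu)%N by rewrite -dE; apply: ltn_ord.
have [c cl ec] := standard_cell pm st qs.
(* The top cell of a column carries a cut; any other cell is a descent from the cell directly above
   it. *)
move: (ec); rewrite e // /f; have [r0|r0] := posnP (val c.1).
  move=> eq; apply/orP; left.
  have jd : (val c.2 < d)%N by rewrite dE; apply: ltn_ord.
  by apply/existsP; exists (Ordinal jd); rewrite /= -eq r0 addn0.
move=> eq; apply/orP; right.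
have [|c' cl' [e1 e2]] := @exists_cell mu (val c.1).-1 (val c.2) pm.
  move: cl; rewrite mem_cells /incell => /leq_trans; apply.
  by apply: partition_nth_leq => //; apply: leq_pred.
apply/existsP; exists c'; apply/existsP; exists c.
apply/and5P; split => //; rewrite ?ec ?mul1n //.
  by rewrite e // /f e1 e2 -eq -addnS prednK.
by rewrite e1 ltn_predL.
Qed.

Lemma colsum_inj d mu nu : is_partition mu -> sumn mu = d ->
  is_partition nu -> sumn nu = d ->
  (forall k, (k < d.+1)%N -> colsum k mu = colsum k nu) -> mu = nu.
Proof.
move=> pm sm pn sn e; apply: partition_eq => // i.
have h j : (j < d)%N -> (j < nth 0%N mu i)%N = (j < nth 0%N nu i)%N.
  move=> jd; rewrite -!partition_nth_count //; congr (_ < _)%N.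
  by have := e j.+1 jd; rewrite !colsumS e ?ltnS 1?ltnW // => /addnI.
case: (ltngtP (nth 0%N mu i) (nth 0%N nu i)) => // l.
  have jd : (nth 0%N mu i < d)%N by apply: leq_trans l _; rewrite -sn nth_leq_sumn.
  by have := h _ jd; rewrite l ltnn.
have jd : (nth 0%N nu i < d)%N by apply: leq_trans l _; rewrite -sm nth_leq_sumn.
by have := h _ jd; rewrite l ltnn.
Qed.

(** The row argument with [signed_coeff] as the functional; triangularity is the same column
    inequality for a single Schur polynomial. *)
Lemma pleth_cols_dominance n N la c mu : (0 < n)%N ->
  is_partition la -> (n * sumn la <= N)%N ->
  schur_expansion (n * sumn la) (pleth_pn_schur n N la) c -> c mu != 0%R ->
  forall k, (colsum k mu <= n * colsum k la)%N.
Proof.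
move=> n0 pl; set d := (n * sumn la)%N => dN exp.
apply: (@schur_expansion_bound N d (d.+1 * d) _ c
  (fun mu => signed_coeff (col_cuts d mu)) (fun mu => \sum_(k < d.+1) colsum k mu)%N
  (fun mu => forall k, (colsum k mu <= n * colsum k la)%N) dN exp).
- by move=> nu a A B; apply: signed_coeff_linear.
- move=> nu pn sn; apply: (@leq_trans (\sum_(k < d.+1) d)); last by rewrite sum_nat_const card_ord.
  by apply: leq_sum => k _; rewrite (leq_trans (colsum_leq_sumn _ _)) ?sn.
- by move=> nu pn sn; apply: signed_coeff_schur_neq0.
- move=> nu xi pn sn px sx; rewrite -pleth_p1_schur => neq ne.
  have dom k : (colsum k nu <= colsum k xi)%N.
    rewrite -[colsum k xi]mul1n; apply: (colsum_leq_of_signed_coeff _ _ _ dN _ neq) => //.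
      by rewrite sx mul1n.
    by rewrite sn.
  split; last by move=> h k; apply: leq_trans (h k).
  case: (sum_ord_lt_or_eq d.+1 dom) => // e.
  by case/eqP: ne; apply/esym/(colsum_inj (d := d)).
- by move=> nu pn sn; apply: colsum_leq_of_signed_coeff => //; rewrite sn.
Qed.

(** * From dominance to the floor bounds *)

(** With [b] the head and [t] the tail of a partition of [s], one has [n * b = n * s - n * t], which
    is at most [n * s - t] because [n] is positive. *)
Lemma leq_divn_of_dominance n s t (r : nat) (x : nat) a b :
  (0 < n)%N -> (r.+1 * x <= a)%N -> (a <= n * b)%N -> (b + t = s)%N ->
  (x <= (n * s - t) %/ r.+1)%N.
Proof.
move=> n0 h1 h2 <-; rewrite leq_divRL // mulnC (leq_trans h1) // (leq_trans h2) //.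
by rewrite mulnDr -addnBA ?leq_addr // leq_pmull.
Qed.

Theorem mainTheorem4 (n : nat) (la mu : seq nat) :
  (0 < n)%N -> is_partition la -> is_partition mu ->
  hall_pleth_nonzero n la mu ->
  (forall r : nat, (1 <= r)%N ->
     (nth 0 mu r.-1 <= (n * sumn la - sumn (drop r la)) %/ r)%N) /\
  (forall c : nat, (1 <= c)%N ->
     (nth 0 (conjpart mu) c.-1
        <= (n * sumn la - sumn (drop c (conjpart la))) %/ c)%N).
Proof.
move=> n0 pl pm [N [dN [c [exp cmu]]]]; split=> -[//|r] _ /=.
  (* The part of index [r] is the smallest of the first [r.+1] parts, so [r.+1] times it is at most
     their sum, which dominance bounds. *)
  apply: (leq_divn_of_dominance n0 _ (pleth_rows_dominance pl dN exp cmu r.+1)).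
    by apply: leq_mul_nonincr_sumn_take => i k; apply: partition_nth_leq.
  by rewrite -sumn_cat cat_take_drop.
apply: (leq_divn_of_dominance n0 _ (pleth_cols_dominance n0 pl dN exp cmu r.+1)).
  rewrite -sumn_take_conjpart; apply: leq_mul_nonincr_sumn_take => i k ik.
  rewrite !nth_conjpart; apply: sub_count => x; exact: leq_ltn_trans.
by rewrite -sumn_take_conjpart -sumn_cat cat_take_drop sumn_conjpart.
Qed.
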